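(* For $n$ odd, there are at least $2^{(n-5)/2}$ pairwise non-homeomorphic 2-page book drawings of $K_n$ with exactly $Z(n)=\frac14\lfloor\frac n2\rfloor\lfloor\frac{n-1}2\rfloor\lfloor\frac{n-2}2\rfloor\lfloor\frac{n-3}2\rfloor$ crossings (crossing optimal drawings).
   Context: A 2-page book drawing of $K_n$ has all vertices on a line (spine) and each edge a simple arc in one of the two closed half-planes bounded by the spine. Two drawings are homeomorphic if there is a homeomorphism of the plane carrying the vertices and edges of one onto the vertices and edges of the other. *)

(* Defs.v *)
From HB Require Import structures.
From mathcomp Require Import all_boot all_order all_fingroup all_algebra.
From mathcomp Require Import all_classical all_reals all_analysis.
Set Implicit Arguments. Unset Strict Implicit. Unset Printing Implicit Defensive.
Import Order.TTheory GRing.Theory Num.Theory.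
Import numFieldNormedType.Exports.
Local Open Scope classical_set_scope.
Local Open Scope ring_scope.

Section BookDrawings.
Variable R : realType.
Notation pt := (R * R)%type.

Definition unitI : set R := [set t | 0 <= t <= 1].
Definition openI : set R := [set t | 0 < t < 1].

Definition simple_arc (g : R -> pt) (a b : pt) : Prop :=
  [/\ {within unitI, continuous g},
      (forall s t, unitI s -> unitI t -> g s = g t -> s = t),
      g 0 = a & g 1 = b].

(* Data of a 2-page book drawing of K_n: the spine is the x-axis,
   vertex i sits at (vx i, 0); for i < j, the edge ij is the arc
   arc i j (from vertex i to vertex j) lying in the upper closed half-plane
   if page i j = true and in the lower closed half-plane otherwise.
   (arc i j and page i j are irrelevant when ~~ (i < j).) *)
Record book_data (n : nat) := BookData {
  vx : 'I_n -> R;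
  arc : 'I_n -> 'I_n -> R -> pt;
  page : 'I_n -> 'I_n -> bool }.

Definition vpt n (D : book_data n) (i : 'I_n) : pt := (vx D i, 0).

Definition is_book_drawing n (D : book_data n) : Prop :=
  injective (vx D) /\
  forall i j : 'I_n, (i < j)%N ->
    [/\ simple_arc (arc D i j) (vpt D i) (vpt D j),
        (forall t, unitI t ->
           if page D i j then 0 <= (arc D i j t).2 else (arc D i j t).2 <= 0)
      &
        (forall t k, unitI t -> arc D i j t = vpt D k -> k = i \/ k = j)].

Definition edge_img n (D : book_data n) (i j : 'I_n) : set pt :=
  if (i < j)%N then arc D i j @` unitI else arc D j i @` unitI.
Definition edge_int n (D : book_data n) (i j : 'I_n) : set pt :=
  if (i < j)%N then arc D i j @` openI else arc D j i @` openI.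

Definition card_is (T : eqType) (A : set T) (m : nat) : Prop :=
  exists s : seq T, [/\ uniq s, size s = m & forall x, x \in s <-> A x].

Definition edge_pair_lt n (i j k l : 'I_n) : bool :=
  [&& (i < j)%N, (k < l)%N & ((i < k)%N || ((i == k) && (j < l)%N))].

Definition crossings_eq n (D : book_data n) (c : nat) : Prop :=
  exists cr : 'I_n -> 'I_n -> 'I_n -> 'I_n -> nat,
    (forall i j k l, edge_pair_lt i j k l ->
       card_is (edge_int D i j `&` edge_int D k l) (cr i j k l)) /\
    (\sum_(i < n) \sum_(j < n) \sum_(k < n) \sum_(l < n | edge_pair_lt i j k l)
        cr i j k l)%N = c.

Definition plane_homeo (h : pt -> pt) : Prop :=
  continuous h /\
  exists h' : pt -> pt, [/\ continuous h', cancel h h' & cancel h' h].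

Definition homeomorphic_drawings n (D1 D2 : book_data n) : Prop :=
  exists h : pt -> pt, plane_homeo h /\
  exists s : {perm 'I_n},
    (forall i, h (vpt D1 i) = vpt D2 (s i)) /\
    (forall i j : 'I_n, (i < j)%N ->
       h @` edge_img D1 i j = edge_img D2 (s i) (s j)).

End BookDrawings.

(* Z(n) = 1/4 * floor(n/2) floor((n-1)/2) floor((n-2)/2) floor((n-3)/2)
   (the product is always divisible by 4). *)
Definition Z (n : nat) : nat :=
  ((n %/ 2) * ((n - 1) %/ 2) * ((n - 2) %/ 2) * ((n - 3) %/ 2)) %/ 4.

(* Main.v *)
Require Import Defs.
From HB Require Import structures.
From mathcomp Require Import all_boot all_order all_fingroup all_algebra.
From mathcomp Require Import all_classical all_reals all_analysis.
From mathcomp Require Import zify ring lra.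
Require Import Defs.
Set Implicit Arguments. Unset Strict Implicit. Unset Printing Implicit Defensive.
Import Order.TTheory GRing.Theory Num.Theory.
Import numFieldNormedType.Exports.

(** Write n = 2m + 1 and read the vertices 0, ..., 2m as the elements of Z/n in
    cyclic order; two edges on the same page cross iff their endpoints
    alternate. Put the edge ij on the upper page if i + j is in {1, ..., m}
    modulo n and on the lower page if it is in {m + 1, ..., 2m}; the edges of the
    axis class i + j = n are pairwise nested and may go on either page.

    Counting: with signs +1, -1 for the pages, twice the number of crossings is
    the sum of 1 + (product of signs) over the alternating pairs. The reflection
    k |-> -k fixes the axis edges and negates the other signs, so axis edges
    contribute nothing; the remaining sum telescopes along the primitive of the
    sign sequence, which is a triangle wave.

    Non-homeomorphism: a homeomorphism preserves the crossing pairs of edges. For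
    m >= 4 the uncrossed edges are exactly the sides of the n-gon, so the
    induced vertex permutation is dihedral. If it moves the axis class onto
    another class, or another class onto it, then the axis edges of the
    corresponding drawing all lie on one page; otherwise it is the identity, or
    the reflection, which exchanges the pages. Fixing the page of the edge
    {1, n - 1} therefore leaves 2^(m-2) pairwise non-homeomorphic drawings. For
    n = 7 some diagonals may be uncrossed, and the two drawings are told apart by
    the sum over the edges of the squared number of crossings. *)

Local Open Scope ring_scope.

(** * The number of crossings *)

Lemma sum_shift_periodic (V : zmodType) (n : nat) (F : nat -> V) c :
  (forall k, F (k + n)%N = F k) ->
  \sum_(0 <= k < n) F (c + k)%N = \sum_(0 <= k < n) F k.
Proof.
move=> FP; elim: c => [|c IH]; first by apply: eq_bigr.
rewrite -{}IH; case: n FP => [|n] FP; first by rewrite !big_geq.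
rewrite big_nat_recr // [RHS]big_nat_recl //= addrC addn0.
congr (_ + _); first by rewrite -(FP c); congr F; lia.
by apply: eq_bigr => k _; congr F; lia.
Qed.

(** Doubling permutes the residues modulo an odd number: [2k + 1] is congruent to
    [2 (k + m + 1)]. *)
Lemma sum_double_periodic (V : zmodType) (m : nat) (F : nat -> V) :
  (forall k, F (k + (2 * m).+1)%N = F k) ->
  \sum_(0 <= k < (2 * m).+1) F (2 * k)%N = \sum_(0 <= k < (2 * m).+1) F k.
Proof.
move=> FP.
have evenodd (j : nat) : \sum_(0 <= k < (2 * j).+1) F k =
    \sum_(0 <= k < j.+1) F (2 * k)%N + \sum_(0 <= k < j) F (2 * k).+1.
  elim: j => [|j IH]; first by rewrite !big_nat1 big_geq // addr0.
  have -> : (2 * j.+1).+1 = (2 * j).+3 by lia.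
  rewrite big_nat_recr // big_nat_recr //= IH.
  rewrite [X in _ = X + _]big_nat_recr // [X in _ = _ + X]big_nat_recr //=.
  have -> : (2 * j.+1)%N = (2 * j).+2 by lia.
  by rewrite -addrA [X in _ + X = _]addrC addrACA.
rewrite evenodd (@big_cat_nat _ _ _ m.+1) //=; last by lia.
congr (_ + _).
have -> : (m.+1 = 0 + m.+1)%N by lia.
rewrite big_addn; have -> : ((2 * m).+1 - m.+1 = m)%N by lia.
by apply: eq_bigr => k _; rewrite -[RHS]FP; congr F; lia.
Qed.

Lemma modn_small_or a n : (a < 2 * n)%N ->
  ((a < n) /\ a %% n = a)%N \/ ((n <= a) /\ a %% n = a - n)%N.
Proof.
move=> lt_a; case: (ltnP a n) => h; [left|right]; split=> //.
  by rewrite modn_small.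
by rewrite -{1}(subnK h) modnDr modn_small; lia.
Qed.

(** * Sums over interlaced quadruples *)

Section CyclicSum.
Variable n : nat.

(* The points i, w, j, x occur in this cyclic order. *)
Definition interlaced (i j w x : nat) : bool :=
  [|| [&& i < w, w < j & j < x], [&& w < j, j < x & x < i],
      [&& j < x, x < i & i < w] | [&& x < i, i < w & w < j]]%N.

(** Using every cyclic labeling, not only [a < b < c < d], lets rotations and reflections act on the
    sum. *)
Definition cyc_sum (f : nat -> nat -> nat -> nat -> int) : int :=
  \sum_(0 <= i < n) \sum_(0 <= j < n) \sum_(0 <= w < n) \sum_(0 <= x < n)
    (interlaced i j w x)%:R * f i j w x.

Definition lin_sum (f : nat -> nat -> nat -> nat -> int) : int :=
  \sum_(0 <= a < n) \sum_(0 <= b < n) \sum_(0 <= c < n) \sum_(0 <= d < n)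
    [&& a < b, b < c & c < d]%N%:R * f a b c d.

Lemma eq_cyc_sum f g : (forall i j w x, (i < n)%N -> (j < n)%N -> (w < n)%N ->
  (x < n)%N -> interlaced i j w x -> f i j w x = g i j w x) -> cyc_sum f = cyc_sum g.
Proof.
move=> fg; apply: eq_big_nat => i /andP[_ hi]; apply: eq_big_nat => j /andP[_ hj].
apply: eq_big_nat => w /andP[_ hw]; apply: eq_big_nat => x /andP[_ hx].
by case: (boolP (interlaced i j w x)) => [s|_]; rewrite ?mul0r // fg.
Qed.

Lemma cyc_sumD f g : cyc_sum (fun i j w x => f i j w x + g i j w x) = cyc_sum f + cyc_sum g.
Proof.
rewrite /cyc_sum -big_split; apply: eq_bigr => i _.
rewrite -big_split; apply: eq_bigr => j _.
rewrite -big_split; apply: eq_bigr => w _.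
rewrite -big_split; apply: eq_bigr => x _.
by rewrite mulrDr.
Qed.

(** The hypothesis is invariance under one step along the cyclic order [i, w, j, x]; each of the
    four exclusive chains in [interlaced] then gives one linear sum. *)
Lemma cyc_sum_lin (f : nat -> nat -> nat -> nat -> int) :
  (forall i j w x, f w x j i = f i j w x) ->
  cyc_sum f = 4%:R * lin_sum (fun a b c d => f a c b d).
Proof.
move=> fC.
have -> : cyc_sum f =
  \sum_(0 <= i < n) \sum_(0 <= j < n) \sum_(0 <= w < n) \sum_(0 <= x < n)
    ([&& i < w, w < j & j < x]%N%:R * f i j w x +
     [&& w < j, j < x & x < i]%N%:R * f w x j i +
     [&& j < x, x < i & i < w]%N%:R * f j i x w +
     [&& x < i, i < w & w < j]%N%:R * f x w i j).
  apply: eq_bigr => i _; apply: eq_bigr => j _.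
  apply: eq_bigr => w _; apply: eq_bigr => x _.
  rewrite (fC j i x w) (fC w x j i) (fC i j w x) -!mulrDl -!natrD.
  by congr (_%:R * _); rewrite /interlaced; lia.
rewrite /lin_sum.
under eq_bigr => i _ do under eq_bigr => j _ do under eq_bigr => w _ do
  rewrite !big_split.
under eq_bigr => i _ do under eq_bigr => j _ do rewrite !big_split.
under eq_bigr => i _ do rewrite !big_split.
rewrite !big_split /=.
set L := RHS.
have -> : L = lin_sum (fun a b c d => f a c b d) + lin_sum (fun a b c d => f a c b d) +
  lin_sum (fun a b c d => f a c b d) + lin_sum (fun a b c d => f a c b d) by rewrite /L; ring.
congr (_ + _ + _ + _); rewrite /lin_sum.
- by apply: eq_bigr => i _; rewrite exchange_big.
- rewrite exchange_big /=.
  under eq_bigr => j _ do rewrite exchange_big /=.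
  rewrite exchange_big /=; apply: eq_bigr => w _; apply: eq_bigr => j _.
  by rewrite exchange_big.
- rewrite exchange_big /=; apply: eq_bigr => j _.
  under eq_bigr => i _ do rewrite exchange_big /=.
  by rewrite exchange_big.
- under eq_bigr => i _ do under eq_bigr => j _ do rewrite exchange_big /=.
  under eq_bigr => i _ do rewrite exchange_big /=.
  rewrite exchange_big /=; apply: eq_bigr => x _; apply: eq_bigr => i _.
  by rewrite exchange_big.
Qed.

Lemma interlaced_shift i l w x : (i < n)%N -> (l < n)%N -> (w < n)%N -> (x < n)%N ->
  interlaced i ((i + l) %% n) ((i + w) %% n) ((i + x) %% n) =
  [&& 0 < w, w < l & l < x]%N.
Proof.
move=> hi hl hw hx; rewrite /interlaced.
have [[] ? ->|[] ? ->] := @modn_small_or (i + l) n ltac:(lia);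
have [[] ? ->|[] ? ->] := @modn_small_or (i + w) n ltac:(lia);
have [[] ? ->|[] ? ->] := @modn_small_or (i + x) n ltac:(lia); lia.
Qed.

Lemma sum_shift_mod (F : nat -> int) c :
  \sum_(0 <= k < n) F k = \sum_(0 <= k < n) F ((c + k) %% n)%N.
Proof.
rewrite (@sum_shift_periodic _ n (fun k => F (k %% n)%N)); last first.
  by move=> k; rewrite modnDr.
by apply: eq_big_nat => k /andP[_ hk]; rewrite modn_small.
Qed.

Lemma periodic_mod (T : Type) (phi : nat -> T) :
  (forall k, phi (k + n)%N = phi k) -> forall k, phi (k %% n)%N = phi k.
Proof.
move=> phiP k; rewrite {2}(divn_eq k n).
elim: (k %/ n)%N => [|q IH]; first by rewrite mul0n.
by rewrite mulSn addnAC -addnA addnC phiP addnC.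
Qed.

(* Rotating the four points so that the first one is 0 decouples the two chords. *)
Lemma cyc_sum_periodic (m : nat) (phi psi : nat -> int) :
  n = (2 * m).+1 ->
  (forall k, phi (k + n)%N = phi k) -> (forall k, psi (k + n)%N = psi k) ->
  cyc_sum (fun i j w x => phi (i + j)%N * psi (w + x)%N) =
  \sum_(0 <= i < n) \sum_(1 <= l < n)
    (\sum_(1 <= v < l) phi (i + v)%N) * (\sum_(l.+1 <= x < n) psi (i + x)%N).
Proof.
move=> hn phiP psiP.
have phiM := periodic_mod phiP; have psiM := periodic_mod psiP.
transitivity (\sum_(0 <= i < n) \sum_(1 <= l < n) \sum_(1 <= w < l)
   \sum_(l.+1 <= x < n) phi (2 * i + l)%N * psi (2 * i + (w + x))%N).
  apply: eq_big_nat => i /andP[_ hi].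
  rewrite (sum_shift_mod _ i) [in LHS](@big_cat_nat _ _ _ 1) //=; last by lia.
  rewrite big_nat1 addn0 [X in X + _]big1 ?add0r; last first.
    move=> w _; rewrite big1 // => x _; rewrite modn_small //.
    by rewrite (_ : interlaced _ _ _ _ = false) ?mul0r // /interlaced; lia.
  apply: eq_big_nat => l /andP[l1 ln].
  rewrite (sum_shift_mod _ i) [in LHS](@big_cat_nat _ _ _ 1) //=; last by lia.
  rewrite big_nat1 addn0 [X in X + _]big1 ?add0r; last first.
    move=> x _; rewrite (modn_small hi).
    by rewrite (_ : interlaced _ _ _ _ = false) ?mul0r // /interlaced; lia.
  rewrite [in LHS](@big_cat_nat _ _ _ l) //=; last by lia.
  rewrite [X in _ + X]big_nat [X in _ + X]big1 ?addr0; last first.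
    move=> w hw; rewrite (sum_shift_mod _ i) big_nat big1 // => x hx.
    by rewrite interlaced_shift //; lia.
  apply: eq_big_nat => w hw.
  rewrite (sum_shift_mod _ i) [in LHS](@big_cat_nat _ _ _ l.+1) //=; try lia.
  rewrite [X in X + _]big_nat [X in X + _]big1 ?add0r; last first.
    by move=> x hx; rewrite interlaced_shift //; lia.
  apply: eq_big_nat => x hx.
  rewrite interlaced_shift //; try lia.
  rewrite (_ : [&& _, _ & _] = true) ?mul1r; last by lia.
  rewrite -phiM -psiM modnDmr modnDmr modnDml phiM psiM.
  by congr (phi _ * psi _); lia.
rewrite exchange_big [RHS]exchange_big /=; apply: eq_big_nat => l /andP[l1 ln].
(* As [n] is odd, [2i] may be replaced by [i]; shifting [i] by [-w] then leaves [w] only in [phi]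
   and [x] only in [psi]. *)
transitivity (\sum_(1 <= w < l) \sum_(l.+1 <= x < n) \sum_(0 <= i < n)
    phi (i + (l - w))%N * psi (i + x)%N).
  rewrite exchange_big /=; apply: eq_big_nat => w hw.
  rewrite exchange_big /=; apply: eq_big_nat => x hx.
  have := @sum_double_periodic _ m (fun i => phi (i + l)%N * psi (i + (w + x))%N).
  rewrite -hn => -> => [|k]; last first.
    by rewrite !(addnAC _ n) phiP psiP.
  rewrite -(@sum_shift_periodic _ n (fun i => phi (i + (l - w))%N * psi (i + x)%N) w).
    by apply: eq_bigr => i _; congr (phi _ * psi _); lia.
  by move=> k; rewrite !(addnAC _ n) phiP psiP.
rewrite big_nat_rev /=.
transitivity (\sum_(1 <= w < l) \sum_(0 <= i < n) \sum_(l.+1 <= x < n)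
    phi (i + w)%N * psi (i + x)%N).
  apply: eq_big_nat => w hw; rewrite exchange_big; apply: eq_bigr => i _.
  by apply: eq_bigr => x _; congr (phi _ * _); lia.
rewrite exchange_big; apply: eq_bigr => i _ /=.
rewrite mulr_suml; apply: eq_bigr => w _.
by rewrite mulr_sumr.
Qed.

End CyclicSum.

Lemma sum_nat_int p : 2%:R * \sum_(0 <= k < p) k%:R = p%:R * (p%:R - 1) :> int.
Proof.
elim: p => [|p IH]; first by rewrite big_geq // mulr0 mul0r.
by rewrite big_nat_recr //= mulrDr IH -natr1; ring.
Qed.

Lemma sum_sqr_int p :
  6%:R * \sum_(0 <= k < p) k%:R ^+ 2 = p%:R * (p%:R - 1) * (2%:R * p%:R - 1) :> int.
Proof.
elim: p => [|p IH]; first by rewrite big_geq // mulr0 !mul0r.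
by rewrite big_nat_recr //= mulrDr IH -natr1; ring.
Qed.

(** * Chord signs and the triangle wave *)

Section ChordColors.
Variables (m n : nat).
Hypothesis hn : n = (2 * m).+1.

Definition sgn_class (k : nat) : int :=
  if (k %% n == 0)%N then 0 else if (k %% n <= m)%N then 1 else -1.

(** A primitive of [sgn_class], rising from 0 at 1 to [m] at [m + 1] and falling to 0 at [n]. The
    truncated predecessor gives 0 at residue 0. *)
Definition wave (k : nat) : int :=
  if (k %% n <= m.+1)%N then (k %% n)%N.-1%:R else (n - k %% n)%N%:R.

(** An axis chord is indexed in [F] by its smaller endpoint; [true] is the upper page. *)
Definition chord_color (F : nat -> bool) (i j : nat) : bool :=
  if (i + j == n)%N then F (minn i j) else ((i + j) %% n <= m)%N.

Definition chord_sign F i j : int := if chord_color F i j then 1 else -1.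

Definition axis_sign (F : nat -> bool) (i j : nat) : int :=
  if (i + j == n)%N then (if F (minn i j) then 1 else -1) else 0.

Lemma sgn_classP k : sgn_class (k + n) = sgn_class k.
Proof. by rewrite /sgn_class modnDr. Qed.

Lemma waveP k : wave (k + n) = wave k.
Proof. by rewrite /wave modnDr. Qed.

Lemma wave_step k : wave k.+1 - wave k = sgn_class k.
Proof.
have lt_r : (k %% n < n)%N by rewrite ltn_mod hn.
rewrite /wave /sgn_class -(addn1 k) -(modnDml k).
move: (k %% n)%N lt_r => r lt_r.
case: (ltnP r (2 * m)) => hr.
  by rewrite modn_small; [do !case: ifP => ?; lia|lia].
have -> : (r + 1 = n)%N by lia.
rewrite modnn /=; do !case: ifP => ?; try lia.
Qed.

Lemma sgn_class_neg k l : ((k + l) %% n = 0)%N -> sgn_class l = - sgn_class k.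
Proof.
rewrite -modnDm /sgn_class.
have: (k %% n < n)%N by rewrite ltn_mod hn.
have: (l %% n < n)%N by rewrite ltn_mod hn.
move: (k %% n)%N (l %% n)%N => a b hb ha.
have [[] ? ->|[] ? ->] := @modn_small_or (a + b) n ltac:(lia); do !case: ifP => ?; lia.
Qed.

Lemma chord_signE F i j : (i < n)%N -> (j < n)%N -> i != j ->
  chord_sign F i j = sgn_class (i + j) + axis_sign F i j.
Proof.
move=> hi hj hij; rewrite /chord_sign /sgn_class /axis_sign /chord_color.
case: eqVneq => [->|hs]; first by rewrite modnn eqxx add0r.
have [[] ? ->|[] ? ->] := @modn_small_or (i + j) n ltac:(lia); do !case: ifP => ?; lia.
Qed.

Lemma sum_rev_mod (f : nat -> int) :
  \sum_(0 <= k < n) f k = \sum_(0 <= k < n) f ((n - k) %% n)%N.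
Proof.
rewrite {1 2}hn [LHS]big_nat_recl // [RHS]big_nat_recl //= subn0 modnn.
congr (_ + _); rewrite big_nat_rev /=; apply: eq_big_nat => k hk.
by rewrite modn_small; [congr f|]; lia.
Qed.

Lemma opp_mod_or k : (k < n)%N ->
  (k = 0 /\ (n - k) %% n = 0)%N \/ (0 < k /\ (n - k) %% n = n - k)%N.
Proof.
case: k => [|k] hk; [left|right]; split=> //; first by rewrite subn0 modnn.
by rewrite modn_small; lia.
Qed.

Lemma antisym_int_eq0 (x : int) : x = - x -> x = 0.
Proof. by move=> ?; lia. Qed.

(* The reflection k |-> -k fixes the chords of the class i + j = n and negates
   the sign of every other class. *)
Lemma cyc_sum_axis_sgn F :
  cyc_sum n (fun i j w x => axis_sign F i j * sgn_class (w + x)) = 0.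
Proof.
rewrite /cyc_sum big_nat big1 // => i /andP[_ hi]; rewrite big_nat big1 // => j /andP[_ hj].
rewrite /axis_sign; case: eqVneq => [eq_ij|_]; last first.
  by rewrite big1 // => w _; rewrite big1 // => x _; rewrite mul0r mulr0.
apply: antisym_int_eq0; rewrite -[in RHS]sumrN [LHS]sum_rev_mod.
apply: eq_big_nat => w /andP[_ hw]; rewrite -[in RHS]sumrN [LHS]sum_rev_mod.
apply: eq_big_nat => x /andP[_ hx].
rewrite (@sgn_class_neg (w + x)); last first.
  case: (opp_mod_or hw) => [[w0 ->]|[w0 ->]]; case: (opp_mod_or hx) => [[x0 ->]|[x0 ->]].
  - by rewrite w0 x0 mod0n.
  - by rewrite (_ : (_ + _ = n)%N) ?modnn //; lia.
  - by rewrite (_ : (_ + _ = n)%N) ?modnn //; lia.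
  - by rewrite (_ : (_ + _ = n + n)%N) ?modnDr ?modnn //; lia.
rewrite !mulrN; congr (- (_%:R * _)).
(* Negation reverses the cyclic order and, as [i + j = n], swaps [i] and [j]; together these
   preserve interlacing. *)
rewrite /interlaced.
by case: (opp_mod_or hw) => [[? ->]|[? ->]]; case: (opp_mod_or hx) => [[? ->]|[? ->]]; lia.
Qed.

Lemma cyc_sumC (f : nat -> nat -> nat -> nat -> int) :
  cyc_sum n f = cyc_sum n (fun i j w x => f x w i j).
Proof.
rewrite /cyc_sum.
under eq_bigr => i _ do rewrite exchange_big /=.
rewrite exchange_big /=.
under eq_bigr => w _ do under eq_bigr => i _ do rewrite exchange_big /=.
under eq_bigr => w _ do rewrite exchange_big /=.
apply: eq_bigr => w _; apply: eq_bigr => x _; rewrite [RHS]exchange_big /=.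
apply: eq_bigr => i _; apply: eq_bigr => j _.
by congr (_%:R * _); rewrite /interlaced; lia.
Qed.

(** Mixed products vanish by the reflection, products of two axis signs because axis chords are
    nested. Hence [F] drops out. *)
Lemma cyc_sum_chord_sign F :
  cyc_sum n (fun i j w x => chord_sign F i j * chord_sign F w x) =
  cyc_sum n (fun i j w x => sgn_class (i + j) * sgn_class (w + x)).
Proof.
transitivity (cyc_sum n (fun i j w x => sgn_class (i + j) * sgn_class (w + x) +
    axis_sign F i j * sgn_class (w + x) + axis_sign F w x * sgn_class (i + j))).
  apply: eq_cyc_sum => i j w x hi hj hw hx; rewrite /interlaced => sep.
  rewrite !chord_signE; try lia.
  have axis2 : axis_sign F i j * axis_sign F w x = 0.
    rewrite /axis_sign; case: eqVneq => [e1|_]; last by rewrite mul0r.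
    by case: eqVneq => [e2|_]; [lia|rewrite mulr0].
  by rewrite mulrDl !mulrDr axis2; ring.
rewrite !cyc_sumD cyc_sum_axis_sgn addr0 [X in _ + X]cyc_sumC.
rewrite [X in _ + X](_ : _ = 0) ?addr0 // -[RHS](cyc_sum_axis_sgn F).
by apply: eq_cyc_sum => i j w x *; rewrite (addnC x).
Qed.

(** Pair [k + 1] on the rising side with [k + m + 1] on the falling side: the values [k] and [m - k]
    add up to [m]. *)
Lemma sum_wave : \sum_(0 <= k < n) wave k = m%:R ^+ 2.
Proof.
rewrite (@big_cat_nat _ _ _ m.+1) //=; last by lia.
rewrite big_nat_recl //= [X in X + _ + _](_ : _ = 0); last by rewrite /wave mod0n.
rewrite add0r.
have -> : (m.+1 = 0 + m.+1)%N by [].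
rewrite big_addn; have -> : (n - m.+1 = m)%N by lia.
rewrite -big_split big_nat /=.
have -> : m%:R ^+ 2 = \sum_(0 <= k < m) m%:R :> int.
  by rewrite sumr_const_nat subn0 expr2 mulr_natr.
rewrite [RHS]big_nat; apply: eq_bigr => k hk.
by rewrite /wave !modn_small; try lia; do !case: ifP => ?; lia.
Qed.

Lemma sum_wave1 : \sum_(0 <= k < n) wave k.+1 = m%:R ^+ 2.
Proof. by rewrite -sum_wave; apply: (@sum_shift_periodic _ n wave 1 waveP). Qed.

Lemma sum_wave_step :
  3%:R * \sum_(0 <= k < n) wave k * wave k.+1 = 2%:R * (m%:R - 1) * m%:R * (m%:R + 1).
Proof.
rewrite (@big_cat_nat _ _ _ m.+1) //=; last by lia.
rewrite big_nat_recl //= [wave 0](_ : _ = 0); last by rewrite /wave mod0n.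
rewrite mul0r add0r.
have -> : (m.+1 = 0 + m.+1)%N by [].
rewrite big_addn; have -> : (n - m.+1 = m)%N by lia.
rewrite -big_split big_nat /=.
have [q qE] : exists q : int, q = m%:R ^+ 2 - m%:R by eexists.
transitivity (3%:R * \sum_(0 <= k < m)
    (2%:R * k%:R ^+ 2 + (2%:R - 2%:R * m%:R) * k%:R + q)).
  congr (_ * _); rewrite qE; rewrite [RHS]big_nat; apply: eq_bigr => k hk.
  have -> : wave k.+1 = k%:R by rewrite /wave modn_small; [case: ifP => ?; lia|lia].
  have -> : wave k.+2 = k.+1%:R by rewrite /wave modn_small; [case: ifP => ?; lia|lia].
  have -> : wave (k + m.+1) = (m - k)%:R by rewrite /wave modn_small; [case: ifP => ?; lia|lia].
  (* For [k + 1 = m] the argument wraps around to [n], where the wave is 0. *)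
  have -> : wave (k + m.+1).+1 = (m - k.+1)%:R.
    case: (ltnP k.+1 m) => hk'; first by rewrite /wave modn_small; [case: ifP => ?; lia|lia].
    by rewrite /wave (_ : (k + m.+1).+1 = n) ?modnn /=; lia.
  by rewrite !natrB; lia.
rewrite !big_split /= -!mulr_sumr sumr_const_nat subn0 -(mulr_natr q).
have := sum_nat_int m; have := sum_sqr_int m.
move: (\sum_(0 <= k < m) k%:R) (\sum_(0 <= k < m) k%:R ^+ 2) => s1 s2 h2 h1.
apply: (@mulfI _ 2%:R) => //.
transitivity (6%:R * s2 * 2%:R + (2%:R * s1) * 3%:R * (2%:R - 2%:R * m%:R) +
  6%:R * q * m%:R); first by ring.
by rewrite h1 h2 qE; ring.
Qed.

Lemma sum_sgn_sqr : \sum_(0 <= k < n) sgn_class k ^+ 2 = 2%:R * m%:R.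
Proof.
rewrite hn big_nat_recl //= {1}/sgn_class mod0n /= expr2 mul0r add0r.
transitivity (\sum_(0 <= k < 2 * m) 1 : int); last first.
  by rewrite sumr_const_nat subn0 natrM.
apply: eq_big_nat => k hk; rewrite /sgn_class modn_small; last by lia.
by rewrite /=; case: ifP.
Qed.

(** The sum is four times the binomial coefficient of [n] over 4; the factor 3 clears the
    denominator. *)
Lemma cyc_sum_one :
  3%:R * cyc_sum n (fun i j w x => 1) = n%:R * m%:R * (2%:R * m%:R - 1) * (2%:R * m%:R - 2%:R).
Proof.
have -> : cyc_sum n (fun i j w x => 1) = \sum_(0 <= i < n) \sum_(1 <= l < n)
    (\sum_(1 <= v < l) 1) * (\sum_(l.+1 <= x < n) 1).
  by rewrite -(@cyc_sum_periodic n m (fun=> 1) (fun=> 1)).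
rewrite sumr_const_nat subn0 [X in X *+ n](_ : _ =
    \sum_(0 <= k < 2 * m) ((2%:R * m%:R - 1) * k%:R - k%:R ^+ 2)); last first.
  rewrite hn big_add1 /=.
  apply: eq_big_nat => k hk; rewrite !sumr_const_nat.
  have -> : ((2 * m).+1 - k.+2 = 2 * m - 1 - k)%N by lia.
  by rewrite subSS subn0 !natrB; lia.
rewrite sumrB -mulr_sumr -(mulr_natr (_ - _)).
have := sum_nat_int (2 * m); have := sum_sqr_int (2 * m).
move: (\sum_(0 <= k < _) k%:R) (\sum_(0 <= k < _) k%:R ^+ 2) => s1 s2 h2 h1.
apply: (@mulfI _ 2%:R) => //.
transitivity ((3%:R * (2%:R * s1) * (2%:R * m%:R - 1) - 6%:R * s2) * n%:R : int); first by ring.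
by rewrite h1 h2 !natrM; ring.
Qed.

Lemma cyc_sum_sgn_class :
  cyc_sum n (fun i j w x => sgn_class (i + j) * sgn_class (w + x)) =
  2%:R * m%:R ^+ 4 - 2%:R * n%:R * (\sum_(0 <= k < n) wave k * wave k.+1) - 2%:R * m%:R.
Proof.
rewrite (cyc_sum_periodic hn sgn_classP sgn_classP).
transitivity (\sum_(0 <= i < n) \sum_(1 <= l < n)
   (wave (i + l) - wave i.+1) * (wave i - wave (i + l).+1)).
  apply: eq_big_nat => i hi; apply: eq_big_nat => l /andP[l1 ln].
  under eq_bigr => v _ do rewrite -wave_step -addnS.
  rewrite telescope_sumr // addn1.
  under eq_bigr => v _ do rewrite -wave_step -addnS.
  by rewrite telescope_sumr // waveP addnS.
(* With [j = i + l], adding the missing term [l = 0], which is [sgn_class i ^+ 2], lets [j] run over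
   a full period. *)
transitivity (\sum_(0 <= i < n) (\sum_(0 <= j < n)
   (wave j - wave i.+1) * (wave i - wave j.+1) - sgn_class i ^+ 2)).
  apply: eq_bigr => i _.
  rewrite -(@sum_shift_periodic _ n
    (fun j => (wave j - wave i.+1) * (wave i - wave j.+1)) i); last first.
    by move=> k; rewrite -addSn !waveP.
  rewrite [in RHS](@big_cat_nat _ _ _ 1) //=; last by lia.
  by rewrite big_nat1 addn0 -wave_step; ring.
rewrite sumrB sum_sgn_sqr.
congr (_ - _).
transitivity (\sum_(0 <= i < n) (wave i * m%:R ^+ 2 - \sum_(0 <= k < n) wave k * wave k.+1
    - (wave i * wave i.+1) *+ n + wave i.+1 * m%:R ^+ 2)).
  apply: eq_bigr => i _.
  transitivity (\sum_(0 <= j < n) (wave j * wave i - wave j * wave j.+1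
      - wave i * wave i.+1 + wave j.+1 * wave i.+1)).
    by apply: eq_bigr => j _; ring.
  rewrite !big_split /= !sumrN sumr_const_nat subn0 -!mulr_suml sum_wave sum_wave1.
  by rewrite !(mulrC (m%:R ^+ 2)).
rewrite !big_split /= !sumrN sumr_const_nat subn0 sumrMnl -!mulr_suml sum_wave sum_wave1.
move: (\sum_(0 <= k < n) _) => g; ring.
Qed.

(* Each crossing is an interlaced quadruple in four ways, and the indicator of
   equal colors is (1 + product of signs) / 2. *)
Lemma lin_sum_same_color F :
  lin_sum n (fun a b c d => (chord_color F a c == chord_color F b d)%:R) = (Z n)%:R.
Proof.
have same2 : 2%:R * lin_sum n (fun a b c d => (chord_color F a c == chord_color F b d)%:R) =
    lin_sum n (fun a b c d => 1 + chord_sign F a c * chord_sign F b d).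
  rewrite /lin_sum mulr_sumr; apply: eq_bigr => a _.
  rewrite mulr_sumr; apply: eq_bigr => b _.
  rewrite mulr_sumr; apply: eq_bigr => c _.
  rewrite mulr_sumr; apply: eq_bigr => d _.
  rewrite mulrCA; congr (_ * _); rewrite /chord_sign.
  by do 2!case: chord_color.
have signC i j : chord_sign F i j = chord_sign F j i.
  by rewrite /chord_sign /chord_color addnC minnC.
have lin4 : 4%:R * lin_sum n (fun a b c d => 1 + chord_sign F a c * chord_sign F b d) =
    cyc_sum n (fun i j w x => 1) +
    cyc_sum n (fun i j w x => sgn_class (i + j) * sgn_class (w + x)).
  rewrite -(cyc_sum_chord_sign F) -cyc_sumD.
  rewrite (@cyc_sum_lin n (fun i j w x => 1 + chord_sign F i j * chord_sign F w x)) //.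
  by move=> i j w x; rewrite (signC j i) [in RHS]mulrC.
move: lin4; rewrite -same2 cyc_sum_sgn_class.
have := cyc_sum_one; have := sum_wave_step.
move: (cyc_sum n _) (\sum_(0 <= k < n) _) (lin_sum n _) => A B C hB hA hC.
have ZE : (Z n)%:R * 4%:R = m%:R ^+ 2 * (m%:R - 1) ^+ 2 :> int.
  rewrite /Z; have -> : (n %/ 2 = m)%N by lia.
  have -> : ((n - 1) %/ 2 = m)%N by lia.
  have -> : ((n - 2) %/ 2 = m - 1)%N by lia.
  have -> : ((n - 3) %/ 2 = m - 1)%N by lia.
  rewrite -natrM divnK; last first.
    have -> : (m * m * (m - 1) * (m - 1) = (m * (m - 1)) * (m * (m - 1)))%N by ring.
    have : (2 %| m * (m - 1))%N.
      by rewrite dvdn2 oddM; case: m => [|k] //; rewrite subn1 /= andNb.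
    by move=> d; rewrite (_ : 4 = 2 * 2)%N // dvdn_mul.
  case: m => [|k]; first by rewrite !mul0n expr2 !mul0r.
  by rewrite !natrM subn1 /= -natr1; ring.
(* Here 24 is 4 labelings times 2 from the page indicator times 3 from the cleared sums. *)
apply: (@mulfI _ 24%:R) => //.
transitivity (3%:R * (4%:R * (2%:R * C))); first by ring.
rewrite hC.
transitivity (3%:R * A + 6%:R * m%:R ^+ 4 - 2%:R * n%:R * (3%:R * B) - 6%:R * m%:R); first by ring.
rewrite hA hB.
transitivity (6%:R * ((Z n)%:R * 4%:R) : int); last by ring.
by rewrite ZE hn -natr1 natrM; ring.
Qed.

End ChordColors.

(** * Symmetries of the crossing relation *)

Definition crosses (p : nat -> nat -> bool) (i j k l : nat) : bool :=
  (interlaced i j k l || interlaced i j l k) && (p i j == p k l).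

(** * Adjacency-preserving maps of a cycle *)

Section Dihedral.
Local Open Scope nat_scope.
Variable n : nat.

Definition rotation (c k : nat) := if c + k < n then c + k else c + k - n.
Definition reflection (c k : nat) := if k <= c then c - k else c + n - k.

Definition cyc_adjacent (i j : nat) : bool :=
  [|| j == i.+1, i == j.+1, (i == 0) && (j == n.-1) | (j == 0) && (i == n.-1)].

(** The images of 0 and 1 fix the direction; afterwards [t k.+2] is the neighbour of [t k.+1] other
    than [t k]. *)
Lemma cyc_adjacent_dihedral (t : nat -> nat) :
  (forall k, k < n -> t k < n) -> {in gtn n &, injective t} ->
  (forall i j, i < n -> j < n -> cyc_adjacent i j -> i != j -> cyc_adjacent (t i) (t j)) ->
  (forall k, k < n -> t k = rotation (t 0) k) \/
  (forall k, k < n -> t k = reflection (t 0) k).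
Proof.
move=> tn tinj tadj.
have step k : k.+2 < n -> [/\ cyc_adjacent (t k) (t k.+1),
   cyc_adjacent (t k.+1) (t k.+2), t k != t k.+2 & t k.+2 < n].
  move=> hk; split; try (by apply: tadj; rewrite /cyc_adjacent; lia).
    by apply/eqP => /tinj; rewrite !inE => e; have := e ltac:(lia) ltac:(lia); lia.
  exact: tn.
have extend (f : nat -> nat) : (forall k, k < 2 -> k < n -> t k = f k) ->
    (forall k, k.+2 < n -> t k = f k -> t k.+1 = f k.+1 -> t k.+2 = f k.+2) ->
    forall k, k < n -> t k = f k.
  move=> base ind k; elim/ltn_ind: k => -[|[|k]] IH hk; try exact: base.
  by apply: ind => //; apply: IH; lia.
case: (ltnP 2 n) => n2; last first.
  left; apply: extend => [k k2 kn|k]; last by lia.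
  case: k k2 kn => [|[|//]] _ kn; rewrite /rotation; first by have := tn 0 kn; case: ifP; lia.
  have := tn 0 ltac:(lia); have := tn 1 kn.
  have : t 0 <> t 1 by move/tinj; rewrite !inE => e; have := e ltac:(lia) ltac:(lia).
  by case: ifP; lia.
have [a01 _ _ _] := step 0 n2; have t0n := tn 0 ltac:(lia); have t1n := tn 1 ltac:(lia).
case: (eqVneq (t 1) (rotation (t 0) 1)) => [e1|ne1]; [left|right]; apply: extend.
- move=> [|[|//]] // _ _; rewrite /rotation; case: ifP; lia.
- move=> k hk; have [] := step k hk; rewrite /cyc_adjacent /rotation => + + + + e e'.
  by rewrite e e'; do !case: ifP => ?; lia.
- move=> [|[|//]] // _ _; move: ne1 a01;
  by rewrite /rotation /reflection /cyc_adjacent ?leq0n; do !case: ifP => ?; lia.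
- move=> k hk; have [] := step k hk; rewrite /cyc_adjacent /reflection => + + + + e e'.
  by rewrite e e'; do !case: ifP => ?; lia.
Qed.

Lemma interlaced_rotation c i j w x : c < n -> i < n -> j < n -> w < n -> x < n ->
  interlaced (rotation c i) (rotation c j) (rotation c w) (rotation c x) = interlaced i j w x.
Proof.
have rotP k : c < n -> k < n ->
    rotation c k < n /\ (rotation c k = c + k \/ rotation c k + n = c + k).
  by rewrite /rotation; case: ifP; lia.
move=> hc hi hj hw hx.
have [ri ei] := rotP i hc hi; have [rj ej] := rotP j hc hj.
have [rw ew] := rotP w hc hw; have [rx ex] := rotP x hc hx.
move: (rotation c i) (rotation c j) (rotation c w) (rotation c x) ri rj rw rx ei ej ew ex.
by rewrite /interlaced => i' j' w' x' ? ? ? ? [] ? [] ? [] ? [] ?; lia.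
Qed.

Lemma interlaced_reflection c i j w x : c < n -> i < n -> j < n -> w < n -> x < n ->
  interlaced (reflection c i) (reflection c j) (reflection c w) (reflection c x) =
  interlaced i j x w.
Proof.
have refP k : c < n -> k < n ->
    reflection c k < n /\ (reflection c k + k = c \/ reflection c k + k = c + n).
  by rewrite /reflection; case: ifP; lia.
move=> hc hi hj hw hx.
have [ri ei] := refP i hc hi; have [rj ej] := refP j hc hj.
have [rw ew] := refP w hc hw; have [rx ex] := refP x hc hx.
move: (reflection c i) (reflection c j) (reflection c w) (reflection c x) ri rj rw rx ei ej ew ex.
by rewrite /interlaced => i' j' w' x' ? ? ? ? [] ? [] ? [] ? [] ?; lia.
Qed.

End Dihedral.

(** * Rigidity of the crossing pattern *)

Section Rigidity.
Local Open Scope nat_scope.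
Variables (m n : nat).
Hypothesis hn : n = (2 * m).+1.

Lemma chord_colorC F i j : chord_color m n F i j = chord_color m n F j i.
Proof. by rewrite /chord_color addnC minnC. Qed.

Lemma chord_color_class F i j k : 0 < k < n -> (i + j = k \/ i + j = k + n) ->
  chord_color m n F i j = (k <= m).
Proof.
move=> hk e; rewrite /chord_color ifN; last by apply/eqP; lia.
by case: e => ->; rewrite ?modnDr modn_small //; lia.
Qed.

Lemma chord_color_axis F i : 0 < i <= m -> chord_color m n F i (n - i) = F i.
Proof.
move=> hi; rewrite /chord_color (_ : i + (n - i) = n) ?eqxx; last by lia.
by congr F; lia.
Qed.

(* [s] and [k] differ by -1, 0 or 1 modulo [n], for [s < 2n] and [k < n]. *)
Definition adjacent_class (s k : nat) : bool :=
  [|| s == k, s + 1 == k, s == k + 1, s == k + n, s + 1 == k + n,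
      s == k + n + 1 | s + 1 == k + n + n].

(** The residue [d] of [k - (i + j)] satisfies [2 <= d <= n - 2]. Moving [i] inward by [u] and [j]
    outward by [d - u] gives class [k]; both shifts can be positive and stay within their arcs. *)
Lemma crossing_class i j k : i < j < n -> 1 < j - i -> ~~ ((i == 0) && (j == n.-1)) ->
  k < n -> ~~ adjacent_class (i + j) k ->
  exists w x, [/\ i < w < j, x < n, (x < i) || (j < x) & w + x = k \/ w + x = k + n].
Proof.
rewrite /adjacent_class => hij dij nend kn away.
have [d [dn dE]] : exists d, d < n /\
    (i + j + d = k \/ i + j + d = k + n \/ i + j + d = k + n + n).
  case: (leqP (i + j) k) => h1; first by exists (k - (i + j)); lia.
  case: (leqP (i + j) (k + n)) => h2; first by exists (k + n - (i + j)); lia.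
  by exists (k + n + n - (i + j)); lia.
pose u := minn (d - 1) (j - i - 1).
pose x := if j + (d - u) < n then j + (d - u) else j + (d - u) - n.
exists (i + u), x; rewrite /x /u; split; try (case: ifP => ?; lia); lia.
Qed.

(** Each page contains classes [k1] and [k1 + 3] because [m >= 4]; the three consecutive classes
    around [i + j] cannot include both. *)
Lemma diagonal_crossed F i j b : 3 < m -> i < j < n -> 1 < j - i ->
  ~~ ((i == 0) && (j == n.-1)) ->
  exists w x, [/\ i < w < j, x < n, (x < i) || (j < x) & chord_color m n F w x = b].
Proof.
move=> m4 hij dij nend.
have [k [bk k0 kn away]] : exists k,
    [/\ (k <= m) = b, 0 < k, k < n & ~~ adjacent_class (i + j) k].
  have [k1 [hb1 hb2 hb3 hb4]] : exists k1,
      [/\ (k1 <= m) = b, (k1 + 3 <= m) = b, k1 + 3 < n & 0 < k1].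
    by case: (b); [exists 1|exists m.+1]; split; lia.
  case: (boolP (adjacent_class (i + j) k1)) => h; last by exists k1; split=> //; lia.
  by exists (k1 + 3); move: h; rewrite /adjacent_class; split; lia.
have [w [x [? ? ? e]]] := crossing_class hij dij nend kn away.
by exists w, x; split=> //; rewrite (chord_color_class _ _ e) ?k0.
Qed.

Variables (F F' : nat -> bool) (s : 'S_n).
Hypothesis crossE : forall i j k l : 'I_n,
  crosses (chord_color m n F) i j k l = crosses (chord_color m n F') (s i) (s j) (s k) (s l).

(** A side crosses nothing, while a diagonal is crossed on its own page; pulling that crossing chord
    back along [s] gives a contradiction. *)
Lemma perm_cyc_adjacent (i j : 'I_n) : 3 < m ->
  cyc_adjacent n i j -> i != j -> cyc_adjacent n (s i) (s j).
Proof.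
move=> m4 adj ij; apply/negPn/negP => nadj.
wlog sij : i j adj ij nadj / s i < s j.
  move=> wl; have := ij; rewrite -(inj_eq (@perm_inj _ s)) neq_ltn => /orP[|lt].
    exact: wl.
  by apply: (wl j i) => //; rewrite ?(eq_sym j) //; move: adj nadj; rewrite /cyc_adjacent; lia.
have si := ltn_ord (s i); have sj := ltn_ord (s j).
have [||| w [x [hw xn hx ec]]] :=
  @diagonal_crossed F' (s i) (s j) (chord_color m n F' (s i) (s j)) m4; first lia.
- by move: nadj; rewrite /cyc_adjacent; lia.
- by move: nadj; rewrite /cyc_adjacent; lia.
have wn : w < n by lia.
have := crossE i j (s^-1 (Ordinal wn))%g (s^-1 (Ordinal xn))%g.
rewrite !permKV /= /crosses ec eqxx andbT.
have -> : interlaced (s i) (s j) w x || interlaced (s i) (s j) x w.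
  by rewrite /interlaced; lia.
have := ltn_ord ((s^-1)%g (Ordinal wn)); have := ltn_ord ((s^-1)%g (Ordinal xn)).
have := ltn_ord i; have := ltn_ord j; move: adj; rewrite /cyc_adjacent /interlaced.
lia.
Qed.

(** The test chord [{0, m}] is on the upper page and interlaces [{i, n - i}] for [0 < i < m], so
    [F i] tells whether the two cross, which [s] preserves. *)
Lemma axis_color_rigid : 3 < m -> F 1 -> F' 1 ->
  (forall i, 0 < i < m -> F i = F' i) \/ (forall i, 0 < i < m -> F i).
Proof.
move=> m4 F1 F'1.
have n0 : 0 < n by lia.
have mn : m < n by lia.
have lt_in i : 0 < i < m -> i < n by lia.
have lt_nin i : 0 < i < m -> n - i < n by lia.
pose t k := val (s (insubd (Ordinal n0) k)).
have tE k (hk : k < n) : t k = s (Ordinal hk).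
  by rewrite /t; congr (val (s _)); apply: val_inj; rewrite val_insubd hk.
have tn k : k < n -> t k < n by move=> hk; rewrite tE.
have tinj : {in gtn n &, injective t}.
  move=> i j; rewrite !inE => hi hj; rewrite !tE => /val_inj/perm_inj.
  by move/(congr1 val).
have tadj i j : i < n -> j < n -> cyc_adjacent n i j -> i != j -> cyc_adjacent n (t i) (t j).
  by move=> hi hj ? ?; rewrite !tE; apply: perm_cyc_adjacent.
have cross_axis i : 0 < i < m -> crosses (chord_color m n F) 0 m i (n - i) =
    crosses (chord_color m n F') (t 0) (t m) (t i) (t (n - i)).
  by move=> hi; rewrite (tE _ n0) (tE _ mn) (tE _ (lt_in i hi)) (tE _ (lt_nin i hi)) -crossE.
have color0m G : chord_color m n G 0 m = true.
  by rewrite (chord_color_class G (k := m)) ?leqnn //; [lia|left].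
have sep0 i : 0 < i < m -> interlaced 0 m i (n - i) by rewrite /interlaced; lia.
have t0 := tn 0 n0.
have key i : 0 < i < m ->
    (interlaced (t 0) (t m) (t i) (t (n - i)) || interlaced (t 0) (t m) (t (n - i)) (t i)) ->
    F i = (chord_color m n F' (t 0) (t m) == chord_color m n F' (t i) (t (n - i))).
  move=> hi sepi; have := cross_axis i hi; rewrite /crosses sepi sep0 // color0m.
  by rewrite chord_color_axis; [case: (F i)|lia].
(* If the axis class lands in a nonzero class [k], the images share one page, so every [F i] equals
   [F 1]. *)
have uniform k : 0 < k < n ->
    (forall i, 0 < i < m -> t i + t (n - i) = k \/ t i + t (n - i) = k + n) ->
    (forall i, 0 < i < m ->
    (interlaced (t 0) (t m) (t i) (t (n - i)) || interlaced (t 0) (t m) (t (n - i)) (t i))) ->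
    forall i, 0 < i < m -> F i.
  move=> hk sums sepi i hi.
  rewrite (key i hi (sepi i hi)) (chord_color_class F' hk (sums i hi)).
  have h1 : 0 < 1 < m by lia.
  by rewrite -(chord_color_class F' hk (sums 1 h1)) -(key 1 h1 (sepi 1 h1)).
have [rot|ref] := cyc_adjacent_dihedral tn tinj tadj.
  have sepi i : 0 < i < m ->
    interlaced (t 0) (t m) (t i) (t (n - i)) || interlaced (t 0) (t m) (t (n - i)) (t i).
    move=> hi; rewrite {1 2}(rot 0 n0) (rot m mn).
    rewrite (rot i (lt_in _ hi)) (rot (n - i) (lt_nin _ hi)).
    by rewrite interlaced_rotation ?sep0 //; lia.
  (* Rotation by [c] sends the axis class to class [2c], nonzero modulo the odd [n] unless
     [c = 0]. *)
  case: (posnP (t 0)) => c0; [left|right].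
    move=> i hi; rewrite (key i hi (sepi i hi)) c0 (rot m mn).
    rewrite (rot i (lt_in _ hi)) (rot (n - i) (lt_nin _ hi)).
    rewrite c0 /rotation !add0n !ifT; try lia.
    by rewrite color0m chord_color_axis; [case: (F' i)|lia].
  apply: (uniform (if t 0 + t 0 < n then t 0 + t 0 else t 0 + t 0 - n)) => //.
    by case: ifP; lia.
  move=> i hi; rewrite (rot i (lt_in _ hi)) (rot (n - i) (lt_nin _ hi)).
  by rewrite /rotation; do !case: ifP => ?; lia.
have sepi i : 0 < i < m ->
    interlaced (t 0) (t m) (t i) (t (n - i)) || interlaced (t 0) (t m) (t (n - i)) (t i).
  move=> hi; rewrite {1 2}(ref 0 n0) (ref m mn).
  rewrite (ref i (lt_in _ hi)) (ref (n - i) (lt_nin _ hi)).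
  by rewrite !interlaced_reflection ?sep0 ?orbT //; lia.
(* The reflection [k |-> -k] sends the test chord to [{0, m + 1}] on the lower page but keeps
   [{1, n - 1}], contradicting [F 1] and [F' 1]. *)
right; case: (posnP (t 0)) => c0.
  have h1 : 0 < 1 < m by lia.
  have := key 1 h1 (sepi 1 h1).
  rewrite c0 (ref m mn) (ref 1 (lt_in _ h1)) (ref (n - 1) (lt_nin _ h1)).
  rewrite c0 /reflection !ifF; try lia.
  rewrite !add0n chord_colorC [X in _ == X]chord_colorC (_ : n - (n - 1) = 1); last by lia.
  rewrite chord_color_axis; last by lia.
  rewrite F1 F'1 (chord_color_class F' (k := n - m)); [|lia|left; lia].
  by lia.
apply: (uniform (if t 0 + t 0 < n then t 0 + t 0 else t 0 + t 0 - n)) => //.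
  by case: ifP; lia.
move=> i hi; rewrite (ref i (lt_in _ hi)) (ref (n - i) (lt_nin _ hi)).
by rewrite /reflection; do !case: ifP => ?; lia.
Qed.

End Rigidity.

Local Open Scope classical_set_scope.
Local Open Scope ring_scope.

(** * Drawings with parabolic arcs *)

Section Homeomorphic.
Variables (R : realType) (n : nat).
Implicit Types D : book_data R n.

(** By injectivity of the arc, the open edge has a description free of the parametrization, which a
    homeomorphism can transport. *)
Lemma edge_intE D (i j : 'I_n) : is_book_drawing D -> i != j ->
  edge_int D i j = edge_img D i j `\` [set vpt D i; vpt D j].
Proof.
move=> [vinj arcs].
have arc_open (a b : 'I_n) : (a < b)%N ->
    arc D a b @` @openI R = arc D a b @` @unitI R `\` [set vpt D a; vpt D b].
  move=> ab; have [[_ inj g0 g1] _ _] := arcs a b ab.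
  have u0 : @unitI R 0 by rewrite /unitI /= lexx ler01.
  have u1 : @unitI R 1 by rewrite /unitI /= lexx ler01.
  apply/seteqP; split=> [_ [t /= /andP[t0 t1] <-]|_ [[t /= /andP[t0 t1] <-] nab]].
    have ut : unitI t by rewrite /unitI /= !ltW.
    split; first by exists t.
    by case=> e; [move: t0|move: t1];
      rewrite ?(inj _ _ ut u0 (etrans e (esym g0))) ?(inj _ _ ut u1 (etrans e (esym g1))) ltxx.
  exists t => //; rewrite /openI /= !lt_neqAle t0 t1 !andbT.
  apply/andP; split; apply/eqP => te; apply: nab.
    by left; rewrite -te g0.
  by right; rewrite te g1.
rewrite /edge_int /edge_img neq_ltn; case: ltnP => ij /= ij'; first exact: arc_open.
by rewrite arc_open // setUC.
Qed.

Lemma homeomorphic_crossing D1 D2 (h : R * R -> R * R) (s : {perm 'I_n}) :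
  is_book_drawing D1 -> is_book_drawing D2 -> plane_homeo h ->
  (forall i, h (vpt D1 i) = vpt D2 (s i)) ->
  (forall i j : 'I_n, (i < j)%N -> h @` edge_img D1 i j = edge_img D2 (s i) (s j)) ->
  forall i j k l : 'I_n, i != j -> k != l ->
    (edge_int D1 i j `&` edge_int D1 k l !=set0) <->
    (edge_int D2 (s i) (s j) `&` edge_int D2 (s k) (s l) !=set0).
Proof.
move=> d1 d2 [_ [h' [_ hK h'K]]] hv he.
have imgC D (i j : 'I_n) : i != j -> edge_img D j i = edge_img D i j.
  by rewrite /edge_img neq_ltn => /orP[] ij; rewrite ij ltnNge ltnW.
have himg (i j : 'I_n) : i != j -> h @` edge_img D1 i j = edge_img D2 (s i) (s j).
  move=> ij; have := ij; rewrite neq_ltn => /orP[/he //|/he].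
  by rewrite imgC // => ->; apply: imgC; rewrite (inj_eq perm_inj).
have hint (i j : 'I_n) : i != j -> h @` edge_int D1 i j = edge_int D2 (s i) (s j).
  move=> ij; rewrite !edge_intE ?(inj_eq perm_inj) // -himg // -!hv.
  apply/seteqP; split=> [_ [P [iP nP] <-]|_ [[P iP <-] nP]].
    split; first by exists P.
    by case=> /(can_inj hK) e; apply: nP; [left|right].
  exists P => //; split=> // -[] e; apply: nP; rewrite e; [by left|by right].
move=> i j k l ij kl; rewrite -!hint //; split=> [[P [P1 P2]]|].
  by exists (h P); split; exists P.
by move=> [_ [[P P1 <-] [Q Q2 /(can_inj hK) QP]]]; exists P; split=> //; rewrite -QP.
Qed.

End Homeomorphic.

(** * Intersections of parabolic arcs *)

Section ParabolaDrawing.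
Variables (R : realType).

(** The graph of [(x - a) (b - x)] or its negative. Distinct ones on one page differ by a nonzero
    affine function, so they meet at most once. *)
Definition parabola_arc (up : bool) (a b t : R) : R * R :=
  (a + t * (b - a), (-1) ^+ (~~ up) * (t * (1 - t) * (b - a) ^+ 2)).

Lemma parabola_arc_continuous up a b : continuous (parabola_arc up a b).
Proof.
move=> t; apply: (cvg_pair (G := nbhs (a + t * (b - a)))
  (H := nbhs ((-1) ^+ (~~ up) * (t * (1 - t) * (b - a) ^+ 2)))).
  apply: cvgD; first exact: cvg_cst.
  by apply: cvgM; [exact: cvg_id|exact: cvg_cst].
apply: cvgM; first exact: cvg_cst.
apply: cvgM; last exact: cvg_cst.
apply: cvgM; first exact: cvg_id.
by apply: cvgB; [exact: cvg_cst|exact: cvg_id].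
Qed.

Definition parabola_drawing n (p : nat -> nat -> bool) : book_data R n :=
  BookData (fun i : 'I_n => i%:R) (fun i j => parabola_arc (p i j) i%:R j%:R)
    (fun i j => p i j).

Lemma parabola_drawingP n p : is_book_drawing (parabola_drawing n p).
Proof.
split=> [i j /eqP|i j ij]; first by rewrite /= eqr_nat => /eqP/val_inj.
have ijR : 0 < (j%:R - i%:R : R) by rewrite subr_gt0 ltr_nat.
split.
- split=> /=.
  + by apply: continuous_subspaceT; exact: parabola_arc_continuous.
  + move=> t u _ _ [/addrI e _]; apply: (mulIf _ e).
    by rewrite gt_eqF.
  + by rewrite /parabola_arc /vpt /= !mul0r mulr0 addr0.
  + by rewrite /parabola_arc /vpt /= mul1r subrr mulr0 mul0r mulr0 addrC subrK.
- move=> t /andP[t0 t1] /=.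
  have t2 : 0 <= t * (1 - t) * (j%:R - i%:R) ^+ 2 :> R.
    by rewrite mulr_ge0 ?sqr_ge0 // mulr_ge0 // subr_ge0.
  by case: (p i j) => /=; rewrite ?expr0 ?expr1 ?mul1r // mulN1r oppr_le0.
move=> t k _ [e /eqP]; rewrite mulf_eq0 signr_eq0 /= mulf_eq0 expf_eq0 (gt_eqF ijR) andbF orbF.
rewrite mulf_eq0 subr_eq0 => /orP[/eqP te|/eqP te]; move: e => /eqP.
  by rewrite te mul0r addr0 eqr_nat => /eqP/val_inj; left.
by rewrite -te mul1r addrC subrK eqr_nat => /eqP/val_inj; right.
Qed.

Lemma parabola_arc_openE up (a b : R) : a < b ->
  parabola_arc up a b @` @openI R =
  [set P | [/\ a < P.1, P.1 < b & P.2 = (-1) ^+ (~~ up) * ((P.1 - a) * (b - P.1))]].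
Proof.
move=> ab; have ba : 0 < b - a by rewrite subr_gt0.
apply/seteqP; split=> [_ [t /= /andP[t0 t1] <-]|[x y] /= [ax xb ->]] /=.
  by split; [nra|nra|congr (_ * _); ring].
exists ((x - a) / (b - a)).
  by rewrite /openI /= divr_gt0 ?subr_gt0 // ltr_pdivrMr // mul1r ltrD2r.
rewrite /parabola_arc; congr (_, _ * _); field; by rewrite gt_eqF.
Qed.

(** Open arcs avoid the spine, so a common point forces equal pages. Of two nested arcs the inner is
    strictly closer to the spine; otherwise an affine equation determines the abscissa. *)
Lemma parabola_meet up up' (a b c d : R) P : a < c \/ a = c /\ b < d ->
  (parabola_arc up a b @` @openI R `&` parabola_arc up' c d @` @openI R) P ->
  a < b -> c < d ->
  [/\ up = up', a < c, c < b, b < d & P.1 = (c * d - a * b) / ((c + d) - (a + b))].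
Proof.
move=> lex + ab cd; rewrite !parabola_arc_openE //; case: P => x y [/= [ax xb ->]] [cx xd].
have ? : 0 < (x - a) * (b - x) by rewrite mulr_gt0 // subr_gt0.
have ? : 0 < (x - c) * (d - x) by rewrite mulr_gt0 // subr_gt0.
move=> e; have eup : up = up'.
  by move: e; case: up; case: up' => //=; rewrite ?expr0 ?expr1 => ?; lra.
have {}e : (x - a) * (b - x) = (x - c) * (d - x).
  by move: e; rewrite eup; apply: mulfI; rewrite signr_eq0.
have [ac cb bd] : [/\ a < c, c < b & b < d].
  have cb : c < b by lra.
  case: lex => [ac|[ac bd]]; last first.
    have : (x - a) * (b - x) < (x - c) * (d - x) by rewrite ac ltr_pM2l; lra.
    by rewrite e ltxx.
  split=> //; rewrite ltNge; apply/negP => db.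
  have : (x - c) * (d - x) < (x - a) * (b - x) by nra.
  by rewrite e ltxx.
split=> //; apply: (canRL (mulfK _)); first by apply/eqP => ?; lra.
by lra.
Qed.

Lemma parabola_meetP up (a b c d : R) : a < c -> c < b -> b < d ->
  exists P, parabola_arc up a b @` @openI R `&` parabola_arc up c d @` @openI R = [set P].
Proof.
move=> ac cb bd.
have ab := lt_trans ac cb; have cd := lt_trans cb bd.
have den : 0 < (c + d) - (a + b) by lra.
pose x := (c * d - a * b) / ((c + d) - (a + b)).
have xE : x * ((c + d) - (a + b)) = c * d - a * b by rewrite /x divfK // gt_eqF.
(* The two bounds amount to [(c - a) (c - b) < 0] and [(b - c) (b - d) < 0]. *)
have cx : c < x by rewrite ltr_pdivlMr //; nra.
have xb : x < b by rewrite ltr_pdivrMr //; nra.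
exists (x, (-1) ^+ (~~ up) * ((x - a) * (b - x))).
apply/seteqP; split=> [P PP|_ ->].
  have [_ _ _ _] := parabola_meet (or_introl ac) PP ab cd.
  move: PP; rewrite !parabola_arc_openE //.
  by case: P => u v [] [/= _ _ ->] _ ->.
rewrite !parabola_arc_openE //; split; split=> //=; try lra.
by congr (_ * _); nra.
Qed.

End ParabolaDrawing.

Section Meeting.
Variable R : realType.

Lemma parabola_arcs_meet up up' (a b c d : nat) :
  (a < b)%N -> (c < d)%N -> a != c ->
  (parabola_arc up a%:R b%:R @` @openI R `&` parabola_arc up' c%:R d%:R @` @openI R !=set0) <->
  (interlaced a b c d || interlaced a b d c) && (up == up').
Proof.
wlog ac : up up' a b c d / (a < c)%N.
  move=> wl ab cd ac; have := ac; rewrite neq_ltn => /orP[{}ac|{}ac].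
    by apply: wl => //; rewrite neq_ltn ac.
  rewrite setIC (eq_sym up).
  have -> : interlaced a b c d || interlaced a b d c = interlaced c d a b || interlaced c d b a.
    by rewrite /interlaced; lia.
  by apply: wl => //; rewrite neq_ltn ac.
move=> ab cd _; have acR : (a%:R < c%:R :> R) by rewrite ltr_nat.
split=> [[P PP]|/andP[sep /eqP <-]].
  have [||->] := parabola_meet (or_introl acR) PP; rewrite ?ltr_nat // => _ cb bd _.
  by rewrite eqxx andbT /interlaced; lia.
have [P ->] := @parabola_meetP R up a%:R b%:R c%:R d%:R acR
  ltac:(by rewrite ltr_nat; move: sep; rewrite /interlaced; lia)
  ltac:(by rewrite ltr_nat; move: sep; rewrite /interlaced; lia).
by exists P.
Qed.

Lemma parabola_drawing_meet n p (i j k l : 'I_n) :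
  (forall a b, p a b = p b a) -> i != j -> k != l -> i != k -> i != l ->
  j != k -> j != l ->
  (edge_int (parabola_drawing R n p) i j `&` edge_int (parabola_drawing R n p) k l !=set0)
  <-> crosses p i j k l.
Proof.
move=> pC; rewrite -!val_eqE /= => ij kl ik il jk jl; rewrite /edge_int /crosses.
move: ij kl; rewrite !neq_ltn.
case: (ltnP i j) => [ij _|_ /= ij]; case: (ltnP k l) => [kl _|_ /= kl];
  rewrite /= parabola_arcs_meet // ?(pC j i) ?(pC l k).
- by rewrite orbC; split.
- rewrite (_ : interlaced j i k l || _ = interlaced i j k l || interlaced i j l k).
    by split.
  by rewrite /interlaced; lia.
- rewrite (_ : interlaced j i l k || _ = interlaced i j k l || interlaced i j l k).
    by split.
  by rewrite /interlaced; lia.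
Qed.

Lemma parabola_drawing_crossings m n F : n = (2 * m).+1 ->
  crossings_eq (parabola_drawing R n (chord_color m n F)) (Z n).
Proof.
move=> hn; pose p := chord_color m n F.
exists (fun i j k l => [&& i < k, k < j & j < l]%N && (p i j == p k l) : nat); split.
  move=> i j k l /and3P[ij kl lex]; rewrite /edge_int ij kl /= -/p.
  have lexR : i%:R < k%:R :> R \/ i%:R = k%:R :> R /\ j%:R < l%:R :> R.
    by rewrite !ltr_nat; case/orP: lex => [|/andP[/eqP->]]; [left|right].
  case: (boolP ([&& i < k, k < j & j < l]%N && (p i j == p k l))) => [|nc] /=.
    case/andP=> /and3P[ik kj jl] /eqP ep.
    have [|||P meet] := @parabola_meetP R (p i j) i%:R j%:R k%:R l%:R; rewrite ?ltr_nat //.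
    by exists [:: P]; split=> // Q; rewrite -ep meet inE; split=> /eqP.
  exists [::]; split=> // Q; split=> // /(parabola_meet lexR).
  rewrite !ltr_nat => /(_ ij kl)[ep ik kj jl _].
  by move: nc; rewrite ik kj jl ep eqxx.
apply/eqP; rewrite -(eqr_nat int) -(lin_sum_same_color hn F) /lin_sum.
rewrite natr_sum big_mkord; apply/eqP; apply: eq_bigr => i _.
rewrite natr_sum big_mkord; under [RHS]eq_bigr => k _ do rewrite big_mkord.
(* Edges [ij] and [kl] are the chords [ac] and [bd], so the two middle sums are exchanged. *)
rewrite exchange_big /=; apply: eq_bigr => j _.
rewrite natr_sum; apply: eq_bigr => k _.
rewrite big_mkord big_mkcond natr_sum /=; apply: eq_bigr => l _.
rewrite /edge_pair_lt -natrM mulnb; congr (_%:R).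
by case: ifP => // ne; case: (boolP (_ && _)) => // /andP[? _]; lia.
Qed.

End Meeting.

(** * An invariant for seven vertices *)

Section CrossingSquares.
Local Open Scope nat_scope.

(** For symmetric [p], eight times the sum over edges of the squared crossing numbers, as pairs are
    ordered. First powers would always add up to a multiple of the crossing number. *)
Definition crossing_squares (n : nat) (p : nat -> nat -> bool) : nat :=
  \sum_(0 <= i < n) \sum_(0 <= j < n)
    (\sum_(0 <= k < n) \sum_(0 <= l < n) crosses p i j k l) ^ 2.

Lemma crossing_squares_perm n p p' (s : 'S_n) :
  (forall i j k l : 'I_n, crosses p i j k l = crosses p' (s i) (s j) (s k) (s l)) ->
  crossing_squares n p = crossing_squares n p'.
Proof.
move=> crossE; rewrite /crossing_squares !big_mkord [RHS](reindex_perm s).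
apply: eq_bigr => i _; rewrite !big_mkord [RHS](reindex_perm s).
apply: eq_bigr => j _; congr (_ ^ _); rewrite !big_mkord [RHS](reindex_perm s).
apply: eq_bigr => k _; rewrite !big_mkord [RHS](reindex_perm s).
by apply: eq_bigr => l _; rewrite crossE.
Qed.

Lemma crossing_squares7 b b' :
  crossing_squares 7 (chord_color 3 7 (nth true [:: true; true; b])) =
  crossing_squares 7 (chord_color 3 7 (nth true [:: true; true; b'])) -> b = b'.
Proof. by case: b; case: b' => //; rewrite /crossing_squares unlock; vm_compute. Qed.

End CrossingSquares.

(** Entry 1 is fixed, entries [2, ..., m - 1] are the free bits, and the default [true] serves the
    side [{m, m + 1}]. *)
Definition axis_pages (f : seq bool) (k : nat) : bool := nth true [:: true, true & f] k.

Lemma axis_pages_rigid m n (f f' : (m - 2).-tuple bool) (s : 'S_n) : n = (2 * m).+1 ->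
  (forall i j k l : 'I_n, crosses (chord_color m n (axis_pages f)) i j k l =
     crosses (chord_color m n (axis_pages f')) (s i) (s j) (s k) (s l)) ->
  f = f'.
Proof.
move=> hn crossE; apply: val_inj.
have tup_eq (g g' : (m - 2).-tuple bool) :
    (forall i, (0 < i < m)%N -> axis_pages g i = axis_pages g' i) -> g = g' :> seq bool.
  move=> gg'; apply: (@eq_from_nth _ true); rewrite !size_tuple // => k hk.
  by apply: (gg' k.+2); lia.
have [m2|m3] := leqP m 2.
  by apply: tup_eq => -[|[|i]] // hi; lia.
have [m4|] := ltnP 3 m; last first.
  move=> m3'; have m3E : m = 3%N by lia.
  rewrite {}m3E in f f' hn crossE {tup_eq m3 m3'} *; subst n.
  have := crossing_squares_perm crossE; rewrite /axis_pages.
  case: f f' {crossE} => [[|b [|? ?]] //= _] [[|b' [|? ?]] //= _].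
  by move/crossing_squares7 => ->.
(* Rigidity is applied to [s] and its inverse: if neither gives equality, both page assignments are
   constantly [true]. *)
have crossEV (i j k l : 'I_n) : crosses (chord_color m n (axis_pages f')) i j k l =
    crosses (chord_color m n (axis_pages f)) (s^-1 i)%g (s^-1 j)%g (s^-1 k)%g (s^-1 l)%g.
  by rewrite crossE !permKV.
case: (axis_color_rigid hn crossE m4 isT isT) => [/tup_eq //|allT].
case: (axis_color_rigid hn crossEV m4 isT isT) => [/tup_eq //|allT'].
by apply: tup_eq => i hi; rewrite allT // allT'.
Qed.

Lemma homeomorphic_crosses (R : realType) n p p' :
  (forall a b, p a b = p b a) -> (forall a b, p' a b = p' b a) ->
  homeomorphic_drawings (parabola_drawing R n p) (parabola_drawing R n p') ->
  exists s : 'S_n, forall i j k l : 'I_n,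
    crosses p i j k l = crosses p' (s i) (s j) (s k) (s l).
Proof.
move=> pC p'C [h [hh [s [hv he]]]]; exists s => i j k l.
have crosses_uniq q (a b c d : 'I_n) : crosses q a b c d ->
    [/\ a != b, c != d & [/\ a != c, a != d, b != c & b != d]].
  by rewrite /crosses /interlaced -!val_eqE /= => /andP[? _]; split; [| |split]; lia.
have meetE := homeomorphic_crossing
  (parabola_drawingP R n p) (parabola_drawingP R n p') hh hv he.
apply/idP/idP => [c|c]; have [ij kl [ik il jk jl]] := crosses_uniq _ _ _ _ _ c.
  have := (parabola_drawing_meet R pC ij kl ik il jk jl).2 c.
  by move/(meetE _ _ _ _ ij kl)/parabola_drawing_meet; apply; rewrite ?(inj_eq perm_inj).
have := (parabola_drawing_meet R p'C ij kl ik il jk jl).2 c.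
move: ij kl ik il jk jl; rewrite !(inj_eq perm_inj) => ij kl ik il jk jl.
by move/(meetE _ _ _ _ ij kl)/parabola_drawing_meet; apply.
Qed.

(* For n odd there are at least 2^((n-5)/2) pairwise non-homeomorphic
   2-page book drawings of K_n with exactly Z(n) crossings.
   (For n = 1, 3 the exponent truncates to 0, i.e. "at least one",
   which is the same as "at least 2^((n-5)/2)" for an integer count.) *)
Theorem theorem23 (R : realType) (n : nat) : odd n ->
  exists (m : nat) (Ds : 'I_m -> book_data R n),
    [/\ (m >= 2 ^ ((n - 5) %/ 2))%N,
        (forall a, is_book_drawing (Ds a) /\ crossings_eq (Ds a) (Z n))
      & (forall a b, a <> b -> ~ homeomorphic_drawings (Ds a) (Ds b))].
Proof.
move=> n_odd; pose m := n./2.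
have hn : n = (2 * m).+1 by rewrite /m; lia.
pose T := {: (m - 2).-tuple bool}.
exists #|T|, (fun a => parabola_drawing R n (chord_color m n (axis_pages (enum_val a : T)))).
split.
(* For [n < 5] both subtractions truncate to 0, so the exponents still agree. *)
- by rewrite card_tuple card_bool (_ : ((n - 5) %/ 2 = m - 2)%N) //; lia.
- move=> a; split; first exact: parabola_drawingP.
  exact: parabola_drawing_crossings.
move=> a b ab /homeomorphic_crosses[||s /(axis_pages_rigid hn)].
- exact: chord_colorC.
- exact: chord_colorC.
by move/enum_val_inj.
Qed.
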